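(* Let $n$ and $k$ be integers with $k\ge 1$ and $n\ge 2k+1$. Then the bipartite Kneser graph $H(n,k)$ is vertex-transitive.
   Context: For a positive integer $n$, let $[n]=\{1,2,\dots,n\}$. For integers $k\ge 1$ and $n\ge 2k+1$, the bipartite Kneser graph $H(n,k)$ is the simple graph whose vertices are all the $k$-element subsets and all the $(n-k)$-element subsets of $[n]$, two distinct vertices $A,B$ being adjacent if and only if $A\subset B$ or $B\subset A$. A graph $\Gamma$ is vertex-transitive if its automorphism group $\mathrm{Aut}(\Gamma)$ acts transitively on its vertex set, i.e. for all vertices $x,y$ there is $\pi\in \mathrm{Aut}(\Gamma)$ with $\pi(x)=y$. *)

(* Defs.v *)
From HB Require Import structures.
From mathcomp Require Import all_boot all_fingroup.

Set Implicit Arguments.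
Unset Strict Implicit.
Unset Printing Implicit Defensive.

Record sgraph := SGraph {
  vertex :> finType;
  adj : rel vertex;
  adj_sym : symmetric adj;
  adj_irrefl : irreflexive adj
}.

Definition Aut_graph (G : sgraph) : {set {perm G}} :=
  [set p : {perm G} | [forall x, forall y, adj (p x) (p y) == adj x y]].

Lemma Aut_graphP (G : sgraph) (p : {perm G}) :
  reflect (forall x y, adj (p x) (p y) = adj x y) (p \in Aut_graph G).
Proof.
rewrite inE; apply: (iffP forallP) => [h x y | h x].
  by have /forallP/(_ y)/eqP := h x.
by apply/forallP => y; rewrite h.
Qed.

Lemma Aut_graph_group_set (G : sgraph) : group_set (Aut_graph G).
Proof.
apply/group_setP; split=> [|p q /Aut_graphP hp /Aut_graphP hq].
  by apply/Aut_graphP => x y; rewrite !perm1.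
by apply/Aut_graphP => x y; rewrite !permM hq hp.
Qed.

Canonical Aut_graph_group (G : sgraph) : {group {perm G}} :=
  Group (Aut_graph_group_set G).

Definition vertex_transitive (G : sgraph) : Prop :=
  forall x y : G, exists2 p : {perm G}, p \in Aut_graph G & p x = y.

(* The ground set {1, ..., n} is rendered as 'I_n, i.e. relabelled {0, ..., n-1}. *)
Section BipartiteKneser.
Variables n k : nat.

Definition bk_vertex : finType :=
  {A : {set 'I_n} | (#|A| == k) || (#|A| == n - k)}.

Definition bk_adj : rel bk_vertex := fun A B =>
  (A != B) && ((val A \subset val B) || (val B \subset val A)).

Lemma bk_adj_sym : symmetric bk_adj.
Proof. by move=> A B; rewrite /bk_adj eq_sym orbC. Qed.

Lemma bk_adj_irrefl : irreflexive bk_adj.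
Proof. by move=> A; rewrite /bk_adj eqxx. Qed.

Definition bipartite_kneser : sgraph := SGraph bk_adj_sym bk_adj_irrefl.

End BipartiteKneser.

(* Main.v *)
Require Import Defs.
From mathcomp Require Import all_boot all_fingroup.

(** Two kinds of injective maps on subsets of the ground set preserve the
    relation of being comparable for inclusion: the image under a permutation
    of the ground set, which preserves inclusion, and complementation, which
    reverses it.  Both send the family of vertices of the bipartite Kneser
    graph to itself, so both induce automorphisms ([bk_aut_of_set_map]).  The
    symmetric group is transitive on subsets of a given size
    ([perm_imset_eq_card]); this moves any vertex to any other of the same
    size, and complementing first moves a vertex of one size to any vertex of
    the other. *)

(** Listing [A] and then its complement, and likewise for [B], gives two
    enumerations of [T] whose first #|A| = #|B| entries are [A] and [B]; the
    permutation matches them position by position. *)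
Lemma perm_imset_eq_card (T : finType) (A B : {set T}) :
  #|A| = #|B| -> exists s : {perm T}, s @: A = B.
Proof.
move=> eqAB.
pose enumC (C : {set T}) := enum C ++ enum (~: C).
have enumC_mem C x : x \in enumC C by rewrite mem_cat !mem_enum inE orbN.
have enumC_uniq C : uniq (enumC C).
  rewrite cat_uniq !enum_uniq andbT; apply/hasPn => x.
  by rewrite !mem_enum inE.
have enumC_size C : size (enumC C) = #|T|.
  by rewrite size_cat -!cardE cardsC.
pose f x := nth x (enumC B) (index x (enumC A)).
have idx_lt x : index x (enumC A) < size (enumC B).
  by rewrite enumC_size -(enumC_size A) index_mem.
have f_inj : injective f.
  move=> x y; rewrite /f (set_nth_default y) // => /eqP.
  by rewrite nth_uniq // => /eqP; apply: index_inj.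
exists (perm f_inj); apply/eqP; rewrite eqEcard card_imset; last exact: perm_inj.
rewrite eqAB leqnn andbT; apply/subsetP => _ /imsetP[x xA ->].
have idxA : index x (enumC A) < size (enum B).
  by rewrite -cardE -eqAB cardE index_cat mem_enum xA index_mem mem_enum.
by rewrite permE /f nth_cat idxA -mem_enum mem_nth.
Qed.

Lemma subset_imset_inj (T U : finType) (f : T -> U) (A B : {set T}) :
  injective f -> (f @: A \subset f @: B) = (A \subset B).
Proof.
move=> f_inj; apply/idP/idP => [/subsetP sAB | ]; last exact: imsetS.
by apply/subsetP => x xA; rewrite -(mem_imset B x f_inj) sAB ?imset_f.
Qed.

(** Adjacency ignores the direction of inclusion, so it is enough that [f]
    preserve comparability; this lets inclusion-reversing maps in.  An injective
    self-map of the finite vertex set is automatically a permutation. *)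
Lemma bk_aut_of_set_map (n k : nat) (f : {set 'I_n} -> {set 'I_n}) :
  injective f ->
  (forall A : {set 'I_n}, (#|A| == k) || (#|A| == n - k) ->
     (#|f A| == k) || (#|f A| == n - k)) ->
  (forall A B : {set 'I_n}, (f A \subset f B) || (f B \subset f A)
             = (A \subset B) || (B \subset A)) ->
  exists2 p : {perm bipartite_kneser n k},
    p \in Aut_graph (bipartite_kneser n k) & forall x, val (p x) = f (val x).
Proof.
move=> f_inj f_vertex f_comparable.
pose g (x : bk_vertex n k) : bk_vertex n k := Sub (f (val x)) (f_vertex _ (valP x)).
have g_inj : injective g.
  by move=> x y /(congr1 val) /f_inj /val_inj.
exists (perm g_inj) => [|x]; last by rewrite permE.
apply/Aut_graphP => x y; rewrite !permE /= /bk_adj (inj_eq g_inj).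
by rewrite f_comparable.
Qed.

Theorem lemma3p1 (n k : nat) (k_ge1 : 1 <= k) (n_ge : 2 * k + 1 <= n) :
  vertex_transitive (bipartite_kneser n k).
Proof.
have le_kn : k <= n.
  by apply: leq_trans n_ge; rewrite mulSn -addnA leq_addr.
move=> x y.
have [eq_xy | neq_xy] := eqVneq #|val x| #|val y|.
  have [s sxy] := perm_imset_eq_card _ _ _ eq_xy.
  have s_inj := @perm_inj _ s.
  have [||A B|p p_aut pE] := bk_aut_of_set_map n k (fun A => s @: A).
  - exact: imset_inj.
  - by move=> A; rewrite card_imset.
  - by rewrite !subset_imset_inj //.
  by exists p => //; apply: val_inj; rewrite pE.
have cardC (A : {set 'I_n}) : #|~: A| = n - #|A|.
  have cardAC : #|A| + #|~: A| = n by rewrite cardsC card_ord.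
  by rewrite -(addKn #|A| #|~: A|) cardAC.
have eq_xCy : #|~: val x| = #|val y|.
  rewrite cardC; move: neq_xy.
  by case/orP: (valP x) => /eqP ->; case/orP: (valP y) => /eqP ->;
     rewrite ?eqxx ?subKn.
have [s sxy] := perm_imset_eq_card _ _ _ eq_xCy.
have s_inj := @perm_inj _ s.
have [||A B|p p_aut pE] := bk_aut_of_set_map n k (fun A => s @: ~: A).
- by move=> A B /(imset_inj s_inj)/setC_inj.
- move=> A; rewrite card_imset // cardC.
  by case/orP=> /eqP ->; rewrite ?subKn // eqxx ?orbT.
- by rewrite !subset_imset_inj // !setCS orbC.
by exists p => //; apply: val_inj; rewrite pE.
Qed.
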